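(* Let $K=\mathbb{Q}$ be the field of rational numbers, let $n$ be a prime number, and let $A=M_n(K)$ be endowed with the Vasilovsky $\mathbb{Z}_n$-grading. Let $f\in K\langle X|\mathbb{Z}_n\rangle$ be a multilinear $\mathbb{Z}_n$-graded polynomial of $\mathbb{Z}_n$-degree $0$. Then the linear span over $K$ of $Im(f)$ (the image of $f$ on $A$) is one of the following: $\{0\}$, $K$ (the set of scalar matrices), $(sl_n(K))_0$ (the set of trace zero diagonal matrices), or $A_0$ (the set of all diagonal matrices).
   Context: Vasilovsky (canonical) $\mathbb{Z}_n$-grading on $A=M_n(K)$: $A=\bigoplus_{g\in\mathbb{Z}_n}A_g$, where $A_g$ is the $K$-span of the matrix units $E_{i,j}$ with $j-i\equiv g \pmod n$. In particular $A_0$ is the set of diagonal matrices. Graded polynomials: $X=\bigcup_{g\in \mathbb{Z}_n}X_g$ is a disjoint union of countable sets of noncommuting variables, and $K\langle X|\mathbb{Z}_n\rangle$ is the free associative unital $K$-algebra on $X$. A variable $x\in X_g$ has $\mathbb{Z}_n$-degree $\deg(x)=g$, and $\deg(x_{i_1}\cdots x_{i_k})=\deg(x_{i_1})+\cdots+\deg(x_{i_k})$. A graded polynomial is homogeneous of $\mathbb{Z}_n$-degree $g$ if it is a linear combination of monomials of $\mathbb{Z}_n$-degree $g$. A graded polynomial in $x_1,\dots,x_m$ is multilinear if it has the form $\sum_{\sigma\in S_m}\alpha_\sigma x_{\sigma(1)}\cdots x_{\sigma(m)}$ with $\alpha_\sigma\in K$. Image: if $g_i=\deg(x_i)$, the image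 $Im(f)$ of $f(x_1,\dots,x_m)$ on $A$ is $\{f(a_1,\dots,a_m) : a_i\in A_{g_i},\ i=1,\dots,m\}$. *)

(* Defs.v *)
From HB Require Import structures.
From mathcomp Require Import all_boot all_order all_fingroup all_algebra.
From mathcomp Require Import finmap.
From mathcomp.multinomials Require Import monalg.

Set Implicit Arguments.
Unset Strict Implicit.
Unset Printing Implicit Defensive.

Import GRing.Theory.
Local Open Scope ring_scope.

(* Everything below is meant for 1 < n: 'Z_0 and 'Z_1 are both Z/2. *)

(* The Vasilovsky component A_g of M_n(K); [i%:R], [j%:R] are the classes in
   Z_n of the (0-based) indices i, j. *)
Definition vasilovsky (K : fieldType) (n : nat) (g : 'Z_n) : {vspace 'M[K]_n} :=
  (\sum_(ij : 'I_n * 'I_n | (ij.2 : nat)%:R - (ij.1 : nat)%:R == g :> 'Z_n)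
     <[delta_mx ij.1 ij.2]>)%VS.

(* X = \bigcup_g X_g: the pair (g, k) is the k-th variable of X_g. *)
Definition gvar (n : nat) : choiceType := ('Z_n * nat)%type.

Definition vdeg (n : nat) (x : gvar n) : 'Z_n := x.1.

(* K<X | Z_n>, as the algebra over K of the free (noncommutative) monoid on X. *)
Notation gpoly K n := {malg K[{fmonom (gvar n)}]} (only parsing).

Definition pvar (K : fieldType) (n : nat) (x : gvar n) : gpoly K n :=
  << fmu x >>.

Definition wdeg (n : nat) (w : {fmonom (gvar n)}) : 'Z_n :=
  \sum_(x <- w) vdeg x.

Definition homogeneous (K : fieldType) (n : nat) (g : 'Z_n) (f : gpoly K n) :=
  forall w, w \in msupp f -> wdeg w = g.

Definition multilinear_in (K : fieldType) (n m : nat) (x : 'I_m -> gvar n)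
    (f : gpoly K n) :=
  exists al : 'S_m -> K,
    f = \sum_(s : 'S_m) al s *: \prod_(i < m) pvar K (x (s i)).

Definition peval (K : fieldType) (n : nat) (a : gvar n -> 'M[K]_n)
    (f : gpoly K n) : 'M[K]_n :=
  \sum_(w <- msupp f) f@_w *: \prod_(y <- w) a y.

(* Only the values a_i = v (x i) are constrained: for f a polynomial in the
   x i, the values of v at the other variables do not affect [peval v f]. *)
Definition graded_image (K : fieldType) (n m : nat) (x : 'I_m -> gvar n)
    (f : gpoly K n) (M : 'M[K]_n) : Prop :=
  exists v : gvar n -> 'M[K]_n,
    (forall i, v (x i) \in vasilovsky K (vdeg (x i))) /\ M = peval v f.

Definition linear_span (K : fieldType) (V : lmodType K) (S : V -> Prop)
    (u : V) : Prop :=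
  exists (k : nat) (c : 'I_k -> K) (s : 'I_k -> V),
    (forall i, S (s i)) /\ u = \sum_(i < k) c i *: s i.

(* Main.v *)
Require Import Defs.
From HB Require Import structures.
From mathcomp Require Import all_boot all_order all_fingroup all_algebra.
From mathcomp Require Import all_field ring.
From mathcomp Require Import finmap.
From mathcomp.multinomials Require Import monalg.
From Stdlib Require Import Classical_Prop.

Set Implicit Arguments.
Unset Strict Implicit.
Unset Printing Implicit Defensive.

Import GRing.Theory.
Local Open Scope ring_scope.

(** Since [f] has degree 0 and the grading is multiplicative, every value of
    [f] is a diagonal matrix ([peval_vasilovsky]); so the span of the image is
    a space [W] of row vectors, read off the diagonals.

    Conjugation by the permutation matrix [C] of the cycle [i |-> 1 + i] is an
    automorphism of M_n(Q) which shifts row and column indices together, hence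
    preserves each graded component. It therefore commutes with evaluating
    [f] and maps the image into itself ([graded_image_cycle]). On a diagonal
    matrix it shifts the diagonal cyclically ([diag_mx_cycle]), so [W] is
    stable under [C]: it is an ideal of Q[X]/(X^n - 1).

    As [n] is prime, X^n - 1 = (X - 1) Phi with Phi = 1 + X + ... + X^(n-1)
    irreducible over Q ([irreducible_geometric_sum]), so there are only four
    ideals. Concretely: if [W] contains a nonconstant vector [d], then the
    polynomial of [d] is prime to Phi, and a Bezout relation shows that [d]
    generates every vector with zero sum ([trace0_sub_cyclic_subspace]).
    The four cases ([subspace_cyclic_cases]) are then the zero space, the
    constant vectors, the vectors of sum zero, and all vectors. *)

(** * Irreducibility of the geometric sum *)

Lemma size_geometric_sum (R : nzRingType) n :
  size (\sum_(i < n) 'X^i : {poly R}) = n.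
Proof.
rewrite (_ : \sum_(i < n) 'X^i = \poly_(i < n) 1) ?size_poly_eq ?oner_eq0 //.
by rewrite poly_def; apply: eq_bigr => i _; rewrite scale1r.
Qed.

(** The sum is, up to a unit, the minimal polynomial over Q of a primitive
    [p]-th root of unity [z]: it vanishes at [z], and its degree is the degree
    [totient p] of the cyclotomic polynomial. A factorization would give a
    proper divisor that vanishes at [z]. *)
Lemma irreducible_geometric_sum p :
  prime p -> irreducible_poly (\sum_(i < p) 'X^i : {poly rat}).
Proof.
move=> p_pr; have p_gt1 := prime_gt1 p_pr.
set Phi : {poly rat} := \sum_(i < p) 'X^i.
have size_Phi : size Phi = p by exact: size_geometric_sum.
have [z prim_z] := C_prim_root_exists (prime_gt0 p_pr).
have z_n1 : z != 1.
  apply: contraTneq p_gt1 => z1; rewrite -leqNgt dvdn_leq //.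
  by rewrite (prim_order_dvd prim_z) z1 expr1.
have root_Phi : root (map_poly ratr Phi) z.
  have: root (map_poly ratr (('X - 1) * Phi)) z.
    rewrite -subrX1 rmorphB /= map_polyXn rmorph1.
    by rewrite /root !hornerE (prim_expr_order prim_z) subrr.
  rewrite rmorphM rootM /= rmorphB rmorph1 /= map_polyX root_XsubC.
  by rewrite (negPf z_n1).
have rootE (d : {poly rat}) : root (map_poly ratr d) z = (Phi %| d).
  have [q [minE _] q_min] := minCpolyP z.
  have size_q : size q = p.
    rewrite -(size_map_poly (ratr : {rmorphism rat -> algC})) -minE.
    rewrite (minCpoly_cyclotomic prim_z) size_cyclotomic totient_prime //.
    by rewrite prednK ?prime_gt0.
  have := root_Phi; rewrite q_min => /dvdp_size_eqp.
  rewrite size_q size_Phi eqxx => /esym q_eqp.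
  by rewrite q_min (eqp_dvdl _ q_eqp).
split=> [|q size_q q_dvd]; first by rewrite size_Phi.
have Phi_n0 : Phi != 0 by rewrite -size_poly_gt0 size_Phi prime_gt0.
have [r PhiE] := dvdpP _ _ q_dvd.
move: root_Phi; rewrite {1}PhiE rmorphM rootM !rootE => /orP[Phi_r | Phi_q].
  case/negP: size_q; rewrite -dvdp1.
  have r_n0 : r != 0 by apply: contraNneq Phi_n0 => r0; rewrite PhiE r0 mul0r.
  by rewrite -(dvdp_mul2l _ _ r_n0) mulr1 -PhiE.
by rewrite /eqp q_dvd.
Qed.

(** * Subspaces stable under the cyclic shift *)

(** Membership is only a proposition: a linear span is given by an existential
    statement, with no algorithm to decide it. *)
Definition subspace (K : fieldType) (V : lmodType K) (W : V -> Prop) :=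
  W 0 /\ forall a u v, W u -> W v -> W (a *: u + v).

Lemma subspace_lin (K : fieldType) (V : lmodType K) (W : V -> Prop) a u v :
  subspace W -> W u -> W v -> W (a *: u + v).
Proof. by case=> _; apply. Qed.

Lemma subspaceZ (K : fieldType) (V : lmodType K) (W : V -> Prop) a u :
  subspace W -> W u -> W (a *: u).
Proof. by case=> W0 WD Wu; rewrite -[_ *: u]addr0; apply: WD. Qed.

Lemma subspace_horner_mx (K : fieldType) n (C : 'M[K]_n.+1)
    (W : 'rV[K]_n.+1 -> Prop) p u :
    subspace W -> (forall u, W u -> W (u *m C)) ->
  W u -> W (u *m horner_mx C p).
Proof.
move=> Wsub WC Wu; elim/poly_ind: p => [|p c IHp].
  by rewrite rmorph0 mulmx0; case: Wsub.
rewrite rmorphD rmorphM /= horner_mx_X horner_mx_C mulmxDr mulmxA mul_mx_scalar.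
by rewrite addrC; apply: subspace_lin => //; apply: WC.
Qed.

(** The type 'Z_k.+2 is convertible to 'I_k.+2, so addition modulo [k.+2] acts
    on matrix indices. *)
Definition cycle (k : nat) : 'S_k.+2 := perm (addrI (1 : 'Z_k.+2)).

Lemma cycleE k (i : 'Z_k.+2) : cycle k i = 1 + i.
Proof. by rewrite permE. Qed.

Lemma delta_cycle_mx (K : fieldType) k (i : 'Z_k.+2) :
  delta_mx 0 i *m perm_mx (cycle k) = delta_mx 0 (1 + i) :> 'rV[K]_k.+2.
Proof. by rewrite -rowE; apply/rowP => j; rewrite !mxE cycleE eq_sym. Qed.

Lemma delta_cycle_mxX (K : fieldType) k i :
  delta_mx 0 0 *m perm_mx (cycle k) ^+ i
    = delta_mx 0 (i%:R : 'Z_k.+2) :> 'rV[K]_k.+2.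
Proof.
elim: i => [|i IHi]; first by rewrite expr0 mulmx1.
by rewrite exprSr mulmxA IHi delta_cycle_mx -mulrS.
Qed.

Lemma rVpoly_sum (R : nzRingType) n (d : 'rV[R]_n) :
  rVpoly d = \sum_(i < n) d 0 i *: 'X^i.
Proof. by rewrite /rVpoly poly_def; apply: eq_bigr => i _; rewrite valK. Qed.

(** With [n = k.+2], row vectors form the cyclic module K[X]/(X^n - 1) over the
    shift, generated by the first basis vector: a vector is the action of its
    own coefficient polynomial on that generator. *)
Lemma delta_horner_cycle_mx (K : fieldType) k (d : 'rV[K]_k.+2) :
  delta_mx 0 0 *m horner_mx (perm_mx (cycle k)) (rVpoly d) = d.
Proof.
rewrite rVpoly_sum rmorph_sum mulmx_sumr [RHS]row_sum_delta.
apply: eq_bigr => i _; rewrite /= horner_mxZ rmorphXn /= horner_mx_X -scalemxAr.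
by rewrite delta_cycle_mxX natr_Zp.
Qed.

(** The cycle has order [k.+2], so its permutation matrix is killed by
    [X^(k.+2) - 1]. *)
Lemma delta_horner_cycle_mx0 (K : fieldType) k (p : {poly K}) :
  delta_mx 0 0 *m horner_mx (perm_mx (cycle k)) (('X^(k.+2) - 1) * p)
    = 0 :> 'rV[K]_k.+2.
Proof.
rewrite rmorphM rmorphB rmorph1 rmorphXn /= horner_mx_X mulmxA mulmxBr mulmx1.
by rewrite delta_cycle_mxX (@pchar_Zp k.+2) // subrr mul0mx.
Qed.

(** The polynomial of [d] has degree at most that of the irreducible
    [Phi], so it is either a scalar multiple of [Phi], in which case [d] is
    constant, or prime to [Phi]. As the first is excluded, write
    [1 = b Phi + a d]. A vector [u] of sum zero is a polynomial divisible by
    [X - 1], so [u b Phi] is a multiple of [X^n - 1] and [u = (u a) d] in the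
    quotient. *)
Lemma trace0_sub_cyclic_subspace k (W : 'rV[rat]_k.+2 -> Prop) d :
    prime k.+2 -> subspace W ->
    (forall u, W u -> W (u *m perm_mx (cycle k))) ->
    W d -> (forall c, d <> const_mx c) ->
  forall u : 'rV[rat]_k.+2, \sum_i u 0 i = 0 -> W u.
Proof.
move=> k_pr Wsub WC Wd d_nconst u u0.
set Phi : {poly rat} := \sum_(i < k.+2) 'X^i.
have PhiE : Phi = rVpoly (const_mx 1 : 'rV_k.+2).
  by rewrite rVpoly_sum; apply: eq_bigr => i _; rewrite mxE scale1r.
have size_Phi : size Phi = k.+2 by exact: size_geometric_sum.
have cop : coprimep Phi (rVpoly d).
  rewrite irreducible_poly_coprime; last exact: irreducible_geometric_sum.
  (* The quotient by [Phi] has degree 0, so [d] is proportional to (1,...,1). *)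
  apply/negP => Phi_d; pose c := (rVpoly d %/ Phi)`_0.
  apply: (d_nconst c); apply: (can_inj rVpolyK); rewrite -(divpK Phi_d).
  rewrite [_ %/ _]size1_polyC; last first.
    rewrite size_divp -?size_poly_gt0 size_Phi //.
    by rewrite leq_subLR addn1 size_poly.
  rewrite -/c mul_polyC PhiE.
  rewrite (_ : const_mx c = c *: const_mx 1) ?linearZ //.
  by apply/rowP => i; rewrite !mxE mulr1.
have [[b a] /= bezout] := Bezout_eq1_coprimepP _ _ cop.
(* The value of the polynomial of [u] at 1 is the sum of the entries of [u]. *)
have /factor_theorem[r uE] : root (rVpoly u) 1.
  rewrite rVpoly_sum /root horner_sum -[X in _ == X]u0; apply/eqP.
  by apply: eq_bigr => i _; rewrite !hornerE expr1n mulr1.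
have -> : u = d *m horner_mx (perm_mx (cycle k)) (rVpoly u * a).
  rewrite -[in RHS](delta_horner_cycle_mx d) -mulmxA mulmxE -rmorphM /=.
  have -> : rVpoly d * (rVpoly u * a)
      = rVpoly u - ('X^(k.+2) - 1) * (r * b).
    have uM : rVpoly u = rVpoly u * (b * Phi + a * rVpoly d).
      by rewrite bezout mulr1.
    rewrite [in RHS]uM subrX1 -/Phi uE polyC1; ring.
  rewrite rmorphB mulmxBr delta_horner_cycle_mx0 subr0.
  by rewrite delta_horner_cycle_mx.
exact: subspace_horner_mx.
Qed.

(** * The Vasilovsky grading and evaluation *)

(** Membership in a component only restricts the positions of the nonzero
    entries; this is the form used for products and shifts. *)
Lemma vasilovskyP (K : fieldType) n (g : 'Z_n) (M : 'M[K]_n) :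
  reflect (forall i j, M i j != 0 -> (j : nat)%:R - (i : nat)%:R = g)
          (M \in vasilovsky K g).
Proof.
apply: (iffP idP) => [/memv_sumP[N NP ->] i j | MP].
  apply: contraNeq => ij_n_g; rewrite summxE big1 // => -[i' j'] /= ij_g.
  have /vlineP[c ->] := NP (i', j') ij_g; rewrite !mxE.
  case: andP ij_n_g => [[/eqP-> /eqP->] | _ _]; first by rewrite ij_g.
  by rewrite mulr0.
rewrite [M]matrix_sum_delta pair_bigA rpred_sum // => -[i j] _ /=.
have [-> | Mij_n0] := eqVneq (M i j) 0; first by rewrite scale0r rpred0.
rewrite rpredZ //; have /eqP ij_g := MP _ _ Mij_n0.
apply: (subvP (sumv_sup (i, j) ij_g (subvv _))); exact: memv_line.
Qed.

Lemma vasilovsky1 (K : fieldType) n : (1 : 'M[K]_n) \in vasilovsky K 0.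
Proof.
apply/vasilovskyP => i j; rewrite mxE.
have [-> _ | _] := eqVneq i j; first exact: subrr.
by rewrite eqxx.
Qed.

Lemma vasilovskyM (K : fieldType) n (g h : 'Z_n) (M N : 'M[K]_n) :
  M \in vasilovsky K g -> N \in vasilovsky K h ->
  M *m N \in vasilovsky K (g + h).
Proof.
move=> /vasilovskyP Mg /vasilovskyP Nh; apply/vasilovskyP => i j.
apply: contraNeq => ij_n_gh; rewrite mxE big1 // => l _.
apply: contraNeq ij_n_gh; rewrite mulf_eq0 negb_or => /andP[/Mg <- /Nh <-].
by rewrite [eqbRHS]addrC subrKA.
Qed.

Lemma vasilovsky_prod (K : fieldType) n (v : gvar n -> 'M[K]_n)
    (w : seq (gvar n)) :
    (forall y, y \in w -> v y \in vasilovsky K (vdeg y)) ->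
  \prod_(y <- w) v y \in vasilovsky K (\sum_(y <- w) vdeg y).
Proof.
elim: w => [|y w IHw] vP; first by rewrite !big_nil vasilovsky1.
rewrite !big_cons; apply: vasilovskyM; first by rewrite vP ?mem_head.
by apply: IHw => z z_w; rewrite vP // inE z_w orbT.
Qed.

(** Only the values of the valuation at the [x i] are controlled, hence the
    need to know that no other variable occurs in the support of [f]. *)
Lemma multilinear_letters (K : fieldType) n m (x : 'I_m -> gvar n)
    (f : gpoly K n) w y :
  multilinear_in x f -> w \in msupp f -> y \in (w : seq _) -> y \in codom x.
Proof.
case=> al ->; rewrite -mcoeff_neq0 => + y_w.
apply: contraNT => y_nx; rewrite raddf_sum /= big1 // => s _.
rewrite mcoeffZ; suff -> : \prod_(i < m) pvar K (x (s i)) =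
   << (\big[mmul/mone]_(i < m) fmu (x (s i)) : {fmonom (gvar n)}) >>.
  rewrite mcoeffU1; case: eqP => [wE | _]; last by rewrite mulr0.
  case/negP: y_nx; move: y_w; rewrite -wE.
  elim/big_ind: _ => [|u v IHu IHv|i _].
  - by rewrite fm1.
  - by rewrite fmM mem_cat => /orP[].
  - by rewrite fmuE inE => /eqP->; apply: codom_f.
elim/big_ind2: _ => // u1 u2 v1 v2 -> ->; rewrite malgM_def fgmulUU mulr1 //.
Qed.

Lemma peval_vasilovsky (K : fieldType) n m (x : 'I_m -> gvar n) g
    (f : gpoly K n) (v : gvar n -> 'M[K]_n) :
    multilinear_in x f -> homogeneous g f ->
    (forall i, v (x i) \in vasilovsky K (vdeg (x i))) ->
  peval v f \in vasilovsky K g.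
Proof.
move=> f_mul f_hom vP; rewrite /peval big_seq; apply: rpred_sum => w w_f.
apply: rpredZ; rewrite -(f_hom w w_f); apply: vasilovsky_prod => y y_w.
by have /codomP[i ->] := multilinear_letters f_mul w_f y_w.
Qed.

Lemma peval_conj (K : fieldType) n (P : 'M[K]_n) (v : gvar n -> 'M[K]_n)
    (f : gpoly K n) :
    P \in unitmx ->
  peval (fun y => invmx P *m v y *m P) f = invmx P *m peval v f *m P.
Proof.
move=> P_unit; rewrite /peval mulmx_sumr mulmx_suml; apply: eq_bigr => w _.
rewrite -scalemxAr -scalemxAl; congr (_ *: _).
elim: (w : seq _) => [|y s IHs]; first by rewrite !big_nil mulmx1 mulVmx.
by rewrite !big_cons IHs -!mulmxE !mulmxA mulmxK.
Qed.

(** The class of [j - i] does not change when both indices are shifted by 1. *)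
Lemma vasilovsky_cycle (K : fieldType) k (g : 'Z_k.+2) (M : 'M[K]_k.+2) :
    M \in vasilovsky K g ->
  invmx (perm_mx (cycle k)) *m M *m perm_mx (cycle k) \in vasilovsky K g.
Proof.
move=> /vasilovskyP Mg; apply/vasilovskyP => i j.
rewrite -[invmx _]/((perm_mx (cycle k))^-1) -perm_mxV -row_permE.
rewrite -[X in _ *m perm_mx X]invgK -col_permE !mxE.
rewrite -{2}[i](permKV (cycle k)) -{2}[j](permKV (cycle k)).
by move=> /Mg <-; rewrite !natr_Zp !cycleE opprD addrACA subrr add0r.
Qed.

Lemma diag_mx_cycle (K : fieldType) k (d : 'rV[K]_k.+2) :
  invmx (perm_mx (cycle k)) *m diag_mx d *m perm_mx (cycle k)
    = diag_mx (d *m perm_mx (cycle k)).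
Proof.
rewrite -mulmxA; apply: (canLR (mulKmx (unitmx_perm _ _))).
rewrite mul_diag_mx mul_mx_diag; apply/matrixP => i j; rewrite !mxE.
have [<- | _] := eqVneq (cycle k i) j; last by rewrite mulr0 mul0r.
rewrite mulr1 mul1r (bigD1 i) //= !mxE eqxx mulr1 big1 ?addr0 // => l l_n_i.
by rewrite !mxE (inj_eq perm_inj) (negPf l_n_i) mulr0.
Qed.

Lemma diag_mx_vasilovsky (K : fieldType) k (M : 'M[K]_k.+2) :
  M \in vasilovsky K 0 <-> exists d, M = diag_mx d.
Proof.
split=> [/vasilovskyP M0 | [d ->]].
  exists (\row_i M i i); apply/matrixP => i j; rewrite !mxE.
  have [-> // | i_n_j] := eqVneq; apply: contraNeq i_n_j; rewrite mulr0n => /M0.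
  by rewrite !natr_Zp => /subr0_eq ->.
apply/vasilovskyP => i j; rewrite mxE.
by have [-> _ | _] := eqVneq i j; [exact: subrr | rewrite eqxx].
Qed.

(** * Linear spans *)

Lemma linear_span_subspace (K : fieldType) (V : lmodType K) (S : V -> Prop) :
  subspace (linear_span S).
Proof.
split=> [|a _ _ [k1 [c1 [s1 [S1 ->]]]] [k2 [c2 [s2 [S2 ->]]]]].
  by exists 0%N, (fun=> 0), (fun=> 0); split=> [[] |]; rewrite ?big_ord0.
exists (k1 + k2)%N.
exists (fun i => match split i with inl i => a * c1 i | inr i => c2 i end).
exists (fun i => match split i with inl i => s1 i | inr i => s2 i end).
split=> [i|]; first by case: (split i).
rewrite big_split_ord scaler_sumr; congr (_ + _); apply: eq_bigr => i _ /=.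
  by rewrite (unsplitK (inl i)) scalerA.
by rewrite (unsplitK (inr i)).
Qed.

Lemma linear_span_linear (K : fieldType) (V : lmodType K) (S T : V -> Prop)
    (h : {linear V -> V}) u :
  (forall v, S v -> T (h v)) -> linear_span S u -> linear_span T (h u).
Proof.
move=> ST [k [c [s [Ss ->]]]]; exists k, c, (h \o s).
split=> [i|]; first exact: ST.
by rewrite linear_sum; apply: eq_bigr => i _; rewrite linearZ.
Qed.

Lemma linear_span_sub (K : fieldType) (V : vectType K) (S : V -> Prop)
    (U : {vspace V}) u :
  (forall v, S v -> v \in U) -> linear_span S u -> u \in U.
Proof.
move=> SU [k [c [s [Ss ->]]]]; apply: rpred_sum => i _.
by rewrite rpredZ // SU.
Qed.

(** * Classification of the span *)

(** The vectors of sum zero form a hyperplane, and the constant vectors a line;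
    so once [W] contains the hyperplane it is the hyperplane or everything,
    and otherwise it is contained in the line. Deciding which case holds is
    classical. *)
Lemma subspace_cyclic_cases k (W : 'rV[rat]_k.+2 -> Prop) :
    prime k.+2 -> subspace W ->
    (forall u, W u -> W (u *m perm_mx (cycle k))) ->
  [\/ forall u, W u <-> u = 0,
      forall u, W u <-> exists c, u = const_mx c,
      forall u, W u <-> \sum_i u 0 i = 0
    | forall u, W u].
Proof.
move=> k_pr Wsub WC.
have [[d Wd d_nconst] | Wconst] :=
    classic (exists2 d, W d & forall c, d <> const_mx c).
  have W_tr0 := trace0_sub_cyclic_subspace k_pr Wsub WC Wd d_nconst.
  have [[e We /eqP e_n0] | Wtr] :=
      classic (exists2 e, W e & \sum_i e 0 i <> 0).
    constructor 4 => u; pose c := (\sum_i u 0 i) / (\sum_i e 0 i).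
    have -> : u = c *: e + (u - c *: e) by rewrite addrC subrK.
    apply: subspace_lin => //; apply: W_tr0.
    rewrite (eq_bigr (fun i => u 0 i - c * e 0 i)); last first.
      by move=> i _; rewrite !mxE.
    by rewrite sumrB -mulr_sumr /c divfK // subrr.
  constructor 3 => u; split=> [Wu | /W_tr0 //].
  by apply: NNPP => u_n0; apply: Wtr; exists u.
have {}Wconst u : W u -> exists c, u = const_mx c.
  move=> Wu; apply: NNPP => u_nconst; apply: Wconst; exists u => // c uE.
  by apply: u_nconst; exists c.
have [[u Wu /eqP u_n0] | W0] := classic (exists2 u, W u & u <> 0).
  constructor 2 => v; split=> [/Wconst // | [a ->]].
  have [c uE] := Wconst u Wu; move: Wu u_n0; rewrite {u}uE => Wc c_n0.
  have {}c_n0 : c != 0.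
    by apply: contraNneq c_n0 => ->; apply/eqP/rowP => i; rewrite !mxE.
  have -> : const_mx a = (a / c) *: const_mx c :> 'rV_k.+2.
    by apply/rowP => i; rewrite !mxE divfK.
  exact: subspaceZ.
constructor 1 => u; split=> [Wu | ->]; last by case: Wsub.
by apply: NNPP => u_n0; apply: W0; exists u.
Qed.

Lemma graded_image_cycle (K : fieldType) k m (x : 'I_m -> gvar k.+2)
    (f : gpoly K k.+2) M :
  graded_image x f M ->
  graded_image x f
    (invmx (perm_mx (cycle k)) *m M *m perm_mx (cycle k)).
Proof.
case=> v [v_graded ->]; rewrite -peval_conj ?unitmx_perm //.
eexists; split; last by []; move=> i /=.
exact: vasilovsky_cycle.
Qed.

Theorem proposition8 (n : nat) (n_prime : prime n)
    (m : nat) (x : 'I_m -> gvar n) (x_inj : injective x)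
    (f : gpoly rat n) (f_multilinear : multilinear_in x f)
    (f_homogeneous : homogeneous 0 f) :
  [\/ forall M : 'M[rat]_n, linear_span (graded_image x f) M <-> M = 0,
      forall M : 'M[rat]_n, linear_span (graded_image x f) M <-> is_scalar_mx M,
      forall M : 'M[rat]_n, linear_span (graded_image x f) M <->
        M \in vasilovsky rat (0 : 'Z_n) /\ \tr M = 0
    | forall M : 'M[rat]_n, linear_span (graded_image x f) M <->
        M \in vasilovsky rat (0 : 'Z_n)].
Proof.
case: n => [|[|k]] // in n_prime x x_inj f f_multilinear f_homogeneous *.
set S := graded_image x f.
have Ssub := linear_span_subspace S.
pose W d := linear_span S (diag_mx d).
have L_A0 M : linear_span S M -> M \in vasilovsky rat 0.
  by apply: linear_span_sub => _ [v [v_graded ->]];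
    apply: (peval_vasilovsky f_multilinear f_homogeneous).
have L_diag M : linear_span S M -> exists2 d, W d & M = diag_mx d.
  move=> LM; have /diag_mx_vasilovsky[d ME] := L_A0 M LM.
  by exists d; rewrite /W -?ME.
have Wsub : subspace W.
  rewrite /W; split=> [|a u v Wu Wv]; first by rewrite linear0; case: Ssub.
  by rewrite linearP; apply: subspace_lin.
have WC u : W u -> W (u *m perm_mx (cycle k)).
  rewrite /W -diag_mx_cycle.
  pose C : 'M[rat]_k.+2 := perm_mx (cycle k).
  apply: (linear_span_linear (h := mulmxr C \o mulmx (invmx C))) => M.
  exact: graded_image_cycle.
have [W0|Wc|Wtr|Wall] := subspace_cyclic_cases n_prime Wsub WC.
- constructor 1 => M; split=> [/L_diag[d /W0-> ->] | ->]; first exact: linear0.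
  by case: Ssub.
- constructor 2 => M; split=> [/L_diag[d /Wc[c ->] ->] | /is_scalar_mxP[c ->]].
    by rewrite diag_const_mx scalar_mx_is_scalar.
  by rewrite -diag_const_mx; apply/Wc; exists c.
- constructor 3 => M; split=> [LM | [/diag_mx_vasilovsky[d ->]]].
    split; first exact: L_A0.
    by have [d /Wtr d0 ->] := L_diag M LM; rewrite mxtrace_diag.
  by rewrite mxtrace_diag => /Wtr.
constructor 4 => M; split=> [/L_A0 // | /diag_mx_vasilovsky[d ->]].
exact: Wall.
Qed.
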